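(* Let $f_1,\dots,f_m:\mathcal{A}\to[0,+\infty)$ be set functions on a family $\mathcal{A}$ as in the context, with $f_1^L,\dots,f_m^L$ their (original, disjoint-pair, $k$-way, or $k$-way disjoint-pair) Lovász extensions and $\mathcal D_{\mathcal A}$ the corresponding feasible domain. Let $p>0$ and let $P,Q:[0,+\infty)^m\to[0,+\infty)$ be positively $p$-homogeneous functions. If $P^{1/p}$ is subadditive and $Q^{1/p}$ is superadditive, then $$\max_{A\in\mathcal A}\frac{P(f_1(A),\dots,f_m(A))}{Q(f_1(A),\dots,f_m(A))}=\sup_{\vec x\in\mathcal D_{\mathcal A}}\frac{P(f_1^L(\vec x),\dots,f_m^L(\vec x))}{Q(f_1^L(\vec x),\dots,f_m^L(\vec x))}.$$ If instead $P^{1/p}$ is superadditive and $Q^{1/p}$ is subadditive, the same identity holds with $\max$ replaced by $\min$ and $\sup$ by $\inf$. Here both sides range over those $A$ (resp. $\vec x$) at which the denominator is positive.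
   Context: Let $V=\{1,\dots,n\}$, $\mathcal P(V)$ its power set, $\mathcal P_2(V)=\{(A,B):A,B\subseteq V,\ A\cap B=\varnothing\}$. For $\vec x\in\mathbb R^V$, $t\in\mathbb R$: $V^t(\vec x)=\{i:x_i>t\}$, $V^t_\pm(\vec x)=\{i:\pm x_i>t\}$. Original Lovász extension of $f:\mathcal P(V)\to\mathbb R$: $f^L(\vec x)=\int_{\min_i x_i}^{\max_i x_i}f(V^t(\vec x))\,dt+f(V)\min_i x_i$. Disjoint-pair Lovász extension of $f:\mathcal P_2(V)\to\mathbb R$: $f^L(\vec x)=\int_0^{\|\vec x\|_\infty}f(V^t_+(\vec x),V^t_-(\vec x))\,dt$. For finite sets $V_i=\{1,\dots,n_i\}$ ($i=1,\dots,k$) and $\vec x=(\vec x^1,\dots,\vec x^k)\in\mathbb R^{V_1}\times\cdots\times\mathbb R^{V_k}$: $k$-way Lovász extension of $f:\mathcal P(V_1)\times\cdots\times\mathcal P(V_k)\to\mathbb R$ is $f^L(\vec x)=\int_{\min\vec x}^{\max\vec x}f(V^t(\vec x^1),\dots,V^t(\vec x^k))dt+f(V_1,\dots,V_k)\min\vec x$ (min/max over all coordinates); $k$-way disjoint-pair extension of $f:\mathcal P_2(V_1)\times\cdots\times\mathcal P_2(V_k)\to\mathbb R$ is $f^L(\vec x)=\int_0^{\|\vec x\|_\infty}f(V^t_+(\vec x^1),V^t_-(\vec x^1),\dots,V^t_+(\vec x^k),V^t_-(\vec x^k))dt$. Families and feasible domains: (i) original: $\{\varnothing,V\}\subseteq\mathcal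 A\subseteq\mathcal P(V)$, $\mathcal D_{\mathcal A}=\{\vec x\in[0,\infty)^n:V^t(\vec x)\in\mathcal A\ \forall t\in\mathbb R\}$; (ii) disjoint-pair: $(\varnothing,\varnothing)\in\mathcal A\subseteq\mathcal P_2(V)$, $\mathcal D_{\mathcal A}=\{\vec x\in\mathbb R^n:(V^t_+(\vec x),V^t_-(\vec x))\in\mathcal A\ \forall t\ge0\}$; (iii) $k$-way: $\{(\varnothing,\dots,\varnothing),(V_1,\dots,V_k)\}\subseteq\mathcal A\subseteq\prod\mathcal P(V_i)$, $\mathcal D_{\mathcal A}=\{\vec x\in[0,\infty)^{n_1+\cdots+n_k}:(V^t(\vec x^1),\dots,V^t(\vec x^k))\in\mathcal A\ \forall t\in\mathbb R\}$; (iv) $k$-way disjoint-pair: $(\varnothing,\dots,\varnothing)\in\mathcal A\subseteq\prod\mathcal P_2(V_i)$, $\mathcal D_{\mathcal A}=\{\vec x:(V^t_\pm(\vec x^i))_{i}\in\mathcal A\ \forall t\ge0\}$. A function $P$ is positively $p$-homogeneous if $P(t\vec a)=t^pP(\vec a)$ for $t>0$.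
   Formalization: The empty set (tuple) is left out of the max/min over A, since the extensions ignore f at it; the max identity also assumes some nonempty A has positive denominator and that P(f(A))=0 whenever Q(f(A))=0 for nonempty A in the family. *)

(* Defs.v *)
From HB Require Import structures.
From mathcomp Require Import all_boot all_order all_algebra.
From mathcomp Require Import all_classical all_reals all_analysis.

Set Implicit Arguments.
Unset Strict Implicit.
Unset Printing Implicit Defensive.

Import Order.TTheory GRing.Theory Num.Theory.
Import numFieldNormedType.Exports.

Local Open Scope ring_scope.

(* V = {1, ..., n} is represented by 'I_n, and R^V by 'rV[R]_n. *)

Definition upper_level (R : realType) n (x : 'rV[R]_n) (t : R) : {set 'I_n} :=
  [set j | t < x 0 j]%SET.

Definition pair_level (R : realType) n (x : 'rV[R]_n) (t : R) :
    {set 'I_n} * {set 'I_n} :=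
  (upper_level x t, upper_level (- x) t).

Section Extensions.
Variable R : realType.

Definition lovasz n (f : {set 'I_n} -> R) (x : 'rV[R]_n) : R :=
  let lo := inf (range (x 0)) in
  let hi := sup (range (x 0)) in
  (\int[lebesgue_measure]_(t in `[lo, hi]) f (upper_level x t))
  + f [set: 'I_n]%SET * lo.

(* `|x| is the sup norm of the row vector x. *)
Definition pair_lovasz n (f : {set 'I_n} * {set 'I_n} -> R) (x : 'rV[R]_n) : R :=
  \int[lebesgue_measure]_(t in `[0, `|x|]) f (pair_level x t).

Section KWay.
Variables (k : nat) (n : 'I_k -> nat).

Definition kset_tuple := {dffun forall i : 'I_k, {set 'I_(n i)}}.

Definition kpair_tuple := {dffun forall i : 'I_k, ({set 'I_(n i)} * {set 'I_(n i)})%type}.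

Definition kvectors := forall i : 'I_k, 'rV[R]_(n i).

Definition kway_level (x : kvectors) (t : R) : kset_tuple :=
  [ffun i => upper_level (x i) t].

Definition kway_pair_level (x : kvectors) (t : R) : kpair_tuple :=
  [ffun i => pair_level (x i) t].

Definition kway_coords (x : kvectors) : set R :=
  (\bigcup_(i in [set: 'I_k]) range (x i 0))%classic.

Definition kway_lovasz (f : kset_tuple -> R) (x : kvectors) : R :=
  let lo := inf (kway_coords x) in
  let hi := sup (kway_coords x) in
  (\int[lebesgue_measure]_(t in `[lo, hi]) f (kway_level x t))
  + f [ffun i => [set: 'I_(n i)]%SET] * lo.

Definition kway_pair_lovasz (f : kpair_tuple -> R) (x : kvectors) : R :=
  \int[lebesgue_measure]_(t in `[0, \big[Num.max/0]_(i < k) `|x i|])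
    f (kway_pair_level x t).

End KWay.
End Extensions.

Inductive lovasz_setting :=
| Original of nat
| DisjointPair of nat
| KWay (k : nat) of 'I_k -> nat
| KWayPair (k : nat) of 'I_k -> nat.

(* The pair types also contain non-disjoint pairs: only the members of an
   admissible family (below) are required to be disjoint. *)
Definition set_tuple (s : lovasz_setting) : finType :=
  match s with
  | Original n => {set 'I_n}
  | DisjointPair n => ({set 'I_n} * {set 'I_n})%type
  | KWay k n => kset_tuple n
  | KWayPair k n => kpair_tuple n
  end.

Definition vectors (R : realType) (s : lovasz_setting) : Type :=
  match s with
  | Original n | DisjointPair n => 'rV[R]_n
  | KWay k n | KWayPair k n => kvectors R n
  end.

Definition empty_of (s : lovasz_setting) : set_tuple s :=
  match s with
  | Original n => finset.set0
  | DisjointPair n => (finset.set0, finset.set0)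
  | KWay k n => [ffun i => finset.set0]
  | KWayPair k n => [ffun i => (finset.set0, finset.set0)]
  end.

Definition admissible (s : lovasz_setting) : {set set_tuple s} -> Prop :=
  match s return {set set_tuple s} -> Prop with
  | Original n => fun F =>
      empty_of (Original n) \in F /\ [set: 'I_n]%SET \in F
  | DisjointPair n => fun F =>
      empty_of (DisjointPair n) \in F /\
      forall A, A \in F -> [disjoint A.1 & A.2]
  | KWay k n => fun F =>
      empty_of (KWay n) \in F /\ [ffun i => [set: 'I_(n i)]%SET] \in F
  | KWayPair k n => fun F =>
      empty_of (KWayPair n) \in F /\
      forall A : kpair_tuple n, A \in F -> forall i, [disjoint (A i).1 & (A i).2]
  end.

Definition lovasz_extension (R : realType) (s : lovasz_setting) :
    (set_tuple s -> R) -> vectors R s -> R :=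
  match s return (set_tuple s -> R) -> vectors R s -> R with
  | Original n => @lovasz R n
  | DisjointPair n => @pair_lovasz R n
  | KWay k n => @kway_lovasz R k n
  | KWayPair k n => @kway_pair_lovasz R k n
  end.

Definition feasible_domain (R : realType) (s : lovasz_setting) :
    {set set_tuple s} -> set (vectors R s) :=
  match s return {set set_tuple s} -> set (vectors R s) with
  | Original n => fun F x =>
      (forall j, 0 <= x 0 j) /\ forall t : R, upper_level x t \in F
  | DisjointPair n => fun F x =>
      forall t : R, 0 <= t -> pair_level x t \in F
  | KWay k n => fun F x =>
      (forall i j, 0 <= x i 0 j) /\ forall t : R, kway_level x t \in F
  | KWayPair k n => fun F x =>
      forall t : R, 0 <= t -> kway_pair_level x t \in F
  end.

(* Functions on the orthant [0, +oo)^m are total functions on 'rV[R]_m, of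
   which only the values at nonnegative vectors are constrained. *)
Section Orthant.
Variables (R : realType) (m : nat).
Implicit Types (G : 'rV[R]_m -> R) (a b : 'rV[R]_m).

Definition orthant a := forall i, 0 <= a 0 i.

Definition nonneg_valued G := forall a, orthant a -> 0 <= G a.

Definition orthant_homogeneous (p : R) G :=
  forall (t : R) a, 0 < t -> orthant a -> G (t *: a) = t `^ p * G a.

Definition orthant_subadditive G :=
  forall a b, orthant a -> orthant b -> G (a + b) <= G a + G b.

Definition orthant_superadditive G :=
  forall a b, orthant a -> orthant b -> G a + G b <= G (a + b).

End Orthant.

Definition set_values (R : realType) (s : lovasz_setting) m (f : 'I_m -> set_tuple s -> R)
    (A : set_tuple s) : 'rV[R]_m :=
  \row_i f i A.

Definition ext_values (R : realType) (s : lovasz_setting) m (f : 'I_m -> set_tuple s -> R)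
    (x : vectors R s) : 'rV[R]_m :=
  \row_i lovasz_extension (f i) x.

(* Lovasz extensions do not depend on the value at the empty set, so the empty
   set is left out of the discrete optimisation. When the f_i vanish there, as
   under the usual normalisation, a positive denominator already
   excludes the empty set. *)
Lemma pos_denom_nonempty (R : realType) (s : lovasz_setting) m
    (f : 'I_m -> set_tuple s -> R) (p : R) (Q : 'rV[R]_m -> R) (A : set_tuple s) :
  0 < p -> orthant_homogeneous p Q -> (forall i, f i (empty_of s) = 0) ->
  0 < Q (set_values f A) -> A != empty_of s.
Proof.
move=> p0 hQ f0; apply: contraTneq => ->.
have -> : set_values f (empty_of s) = 0 by apply/rowP => i; rewrite !mxE f0.
have : Q (2 *: 0) = 2 `^ p * Q 0 by apply: hQ => // i; rewrite mxE.
rewrite scaler0 -leNgt => /eqP; rewrite -subr_eq0 -{1}[Q 0]mul1r -mulrBl mulf_eq0.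
case/orP => [|/eqP -> //]; rewrite subr_eq0 eq_sym powR_eq1 (gt_eqF p0) orbF.
by rewrite pnatr_eq1 /= ltNge ler0n.
Qed.

(* Main.v *)
(* A Lovasz extension is linear in f: since the level sets of x take finitely
   many values, f^L(x) = sum_A c_A f(A), where c_A >= 0 is the length of the set
   of levels t at which the level set equals A (plus min x when A = V, for the
   extensions built on upper level sets), and c_A
   vanishes unless A is a nonempty member of the family. When P <= K Q at all
   vectors (f_1(A), ..., f_m(A)), the 1-homogeneous functions P^(1/p), subadditive,
   and Q^(1/p), superadditive, turn this decomposition into P <= K Q at
   (f_1^L(x), ..., f_m^L(x)). Conversely f^L restricts to f on (signed) indicator
   vectors. The min/inf case is the same bound with P and Q exchanged. *)
Require Import Defs.
From mathcomp Require Import all_boot all_order all_algebra.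
From mathcomp Require Import all_classical all_reals all_analysis.
Import Order.TTheory GRing.Theory Num.Theory.
Import numFieldNormedType.Exports.
Local Open Scope ring_scope.

(** * Integrals over levels as finite weighted sums *)

(** The weight [c A] is the measure of the levels in [[a, b[] at which [g] equals [A], since
    [f \o g] is a finite combination of indicators of fibres of [g]. The weights are chosen before
    [f], so that one family serves all the [f_i]. *)
Lemma level_integral_sum {R : realType} {T : finType} (g : R -> T) (D : pred T) (a b : R) :
  (forall A, measurable (g @^-1` [set A])%classic) ->
  (forall t, a <= t < b -> D (g t)) ->
  exists2 c : T -> R, forall A, 0 <= c A
  & forall f : T -> R,
    \int[lebesgue_measure]_(t in `[a, b]) f (g t) = \sum_(A | D A) c A * f A.
Proof.
(* Half-open, because at the top level [b] the level set may be empty and violate [D]; the endpoint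
   is a null set. *)
move=> mg gD; pose I : set R := `[a, b[%classic.
have mI : measurable I by exact: measurable_itv.
pose ind A : R -> R := \1_(g @^-1` [set A])%classic.
have iind A : lebesgue_measure.-integrable I (EFin \o ind A).
  apply: measurable_bounded_integrable => //.
  - by rewrite /= lebesgue_measure_itv/=; case: ifP => _; rewrite ?ltry// -EFinB ltry.
  - exact: (@measurable_realfun.measurable_indic _ _ R I _ (mg A)).
  - exists 1; split => // x x1 t _; rewrite /= /ind indicE (le_trans _ (ltW x1))//.
    by case: (_ \in _); rewrite /= ?normr0 ?normr1.
exists (fun A => \int[lebesgue_measure]_(t in I) ind A t) => [A|f].
  by apply: Rintegral_ge0 => t _; rewrite /ind indicE.
pose h A t := f A * ind A t.
have gE t : I t -> f (g t) = \sum_(A | D A) h A t.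
  move=> It; rewrite (bigD1 (g t)) /=; last by apply: gD; move: It; rewrite /I/= in_itv.
  rewrite big1 ?addr0 => [|A /andP[_ /eqP Ag]].
    by rewrite /h /ind indicE mem_set// mulr1.
  by rewrite /h /ind indicE memNset ?mulr0// => /= /esym.
have ih A : lebesgue_measure.-integrable I (EFin \o h A).
  have -> : EFin \o h A = (fun t => (f A)%:E * (EFin \o ind A) t)%E.
    by apply/funext => t; rewrite /= EFinM.
  exact: integrableZl.
have hE : EFin \o (fun t => \sum_(A | D A) h A t) =
    (fun t => \sum_(A | D A) (EFin \o h A) t)%E.
  by apply/funext => t; rewrite /= sumEFin.
have ig : lebesgue_measure.-integrable I (EFin \o (f \o g)).
  apply: (@eq_integrable _ _ _ lebesgue_measure _ mI (EFin \o (fun t => \sum_(A | D A) h A t))).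
    by move=> t /set_mem It; rewrite /= gE.
  by rewrite hE; apply: integrable_sum.
transitivity (\int[lebesgue_measure]_(t in I) (f \o g) t).
  by rewrite -Rintegral_itv_bndo_bndc.
transitivity (\int[lebesgue_measure]_(t in I) (\sum_(A | D A) h A t)).
  by apply: eq_Rintegral => t /set_mem It; rewrite /= gE.
transitivity (fine (\int[lebesgue_measure]_(t in I) \sum_(A | D A) (EFin \o h A) t)%E).
  by rewrite -hE.
rewrite integral_sum// -sum_fine; last first.
  by move=> A _; exact: integrable_fin_num.
by apply: eq_bigr => A _; rewrite mulrC -RintegralZl.
Qed.

(** Each coordinate confines [t] to a ray, open if [j] lies in [A] and closed otherwise. *)
Lemma upper_level_measurable {R : realType} n (x : 'rV[R]_n) (A : {set 'I_n}) :
  measurable (upper_level x @^-1` [set A])%classic.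
Proof.
have -> : (upper_level x @^-1` [set A] =
    \bigcap_(j in [set: 'I_n]) [set t | (t < x 0 j) = (j \in A)])%classic.
  apply/seteqP; split=> t /=.
    by move=> <- j _ /=; rewrite inE.
  by move=> tA; apply/setP => j; rewrite inE; exact: tA.
apply: fin_bigcap_measurable => // j _.
case: (j \in A).
  by rewrite -set_itvNyo; exact: measurable_itv.
have -> : ([set t | (t < x 0 j) = false] = `[x 0 j, +oo[)%classic.
  by apply/seteqP; split=> t /=; rewrite in_itv/= andbT leNgt;
    [move=> ->|move/negbTE].
exact: measurable_itv.
Qed.

Lemma pair_level_measurable {R : realType} n (x : 'rV[R]_n) A :
  measurable (pair_level x @^-1` [set A])%classic.
Proof.
have -> : (pair_level x @^-1` [set A] =
    (upper_level x @^-1` [set A.1]) `&` (upper_level (- x) @^-1` [set A.2]))%classic.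
  by apply/seteqP; split=> t /=; [move=> <-|case: A => A B /= [<- <-]].
by apply: measurableI; exact: upper_level_measurable.
Qed.

Lemma dffun_measurable {R : realType} k (T : 'I_k -> finType) (g : forall i, R -> T i) :
  (forall i A, measurable (g i @^-1` [set A])%classic) ->
  forall A : {dffun forall i, T i},
  measurable ((fun t => [ffun i => g i t] : {dffun forall i, T i}) @^-1` [set A])%classic.
Proof.
move=> mg A.
have -> : ((fun t => [ffun i => g i t] : {dffun forall i, T i}) @^-1` [set A] =
    \bigcap_(i in [set: 'I_k]) (g i @^-1` [set A i]))%classic.
  apply/seteqP; split=> t /=.
    by move=> <- i _ /=; rewrite ffunE.
  by move=> tA; apply/ffunP => i; rewrite ffunE; exact: tA.
by apply: fin_bigcap_measurable => // j _.
Qed.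

(** Here [S] stands for the set of coordinates, [e] for the empty set and [top] for V. Below [sup S]
    some coordinate exceeds [t], so the level set is not [e]; the shift adds [inf S >= 0] to the
    weight of [top]. *)
Lemma shifted_integral_sum {R : realType} {T : finType} (g : R -> T) (S : set R)
    (e top : T) (F : {set T}) :
  (forall A, measurable (g @^-1` [set A])%classic) ->
  (forall t, g t \in F) -> top \in F ->
  (forall y, S y -> 0 <= y) ->
  (forall t y, S y -> t < y -> g t != e) ->
  ((S !=set0)%classic -> top != e) ->
  exists2 c : T -> R, forall A, 0 <= c A
  & forall f : T -> R,
    \int[lebesgue_measure]_(t in `[inf S, sup S]) f (g t) + f top * inf S
    = \sum_(A in F | A != e) c A * f A.
Proof.
move=> mg gF topF S0 ge tope.
have [|c c0 cE] := level_integral_sum g (fun A => (A \in F) && (A != e)) (inf S) (sup S) mg.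
  move=> t /andP[St tS]; rewrite gF /=; have [S_0|/set0P S_n0] := eqVneq S set0.
    by move: St tS; rewrite S_0 inf0 sup0 => /le_lt_trans/[apply]; rewrite ltxx.
  by have [y Sy] := sup_gt S_n0 tS; exact: ge.
(* Without coordinates, [inf S] defaults to 0 and the shift vanishes; [top] may then coincide with
   [e]. *)
have [S_0|/set0P S_n0] := eqVneq S set0.
  by exists c => // f; rewrite cE S_0 inf0 mulr0 addr0.
exists (fun A => c A + (A == top)%:R * inf S) => [A|f].
  by rewrite addr_ge0// mulr_ge0// lb_le_inf.
rewrite cE (bigD1 top)/= ?topF ?tope// [RHS](bigD1 top)/= ?topF ?tope//.
rewrite eqxx mul1r mulrDl addrAC [f top * _]mulrC; congr (_ + _).
by apply: eq_bigr => A /andP[_ /negbTE ->]; rewrite mul0r addr0.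
Qed.

(** * Integrals along indicator vectors *)

Lemma step_integral {R : realType} {T : Type} (g : R -> T) (A : T) (f : T -> R) :
  (forall t, 0 <= t < 1 -> g t = A) ->
  \int[lebesgue_measure]_(t in `[0, 1]) f (g t) = f A.
Proof.
move=> gA.
transitivity (\int[lebesgue_measure]_(t in `[0%R, 1%R[) (cst (f A) t)); last first.
  rewrite Rintegral_cst ?measurable_itv//= lebesgue_measure_itv/= lte_fin ltr01.
  by rewrite -EFinB subr0/= mulr1.
have mI : measurable (`[0%R, 1%R[%classic : set R) by exact: measurable_itv.
have fE t : (`[0%R, 1%R[%classic : set R) t -> cst (f A) t = f (g t).
  by rewrite /= in_itv/= => /gA ->.
have ic : lebesgue_measure.-integrable `[0%R, 1%R[%classic (EFin \o cst (f A) : R -> \bar R).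
  apply: measurable_bounded_integrable => //.
    by rewrite /= lebesgue_measure_itv/= lte_fin ltr01 -EFinB ltry.
  by exists `|f A|; split => // x /ltW fx t _.
rewrite -Rintegral_itv_bndo_bndc.
  by apply: eq_Rintegral => t /set_mem /fE.
apply: (@eq_integrable _ _ _ lebesgue_measure _ mI (EFin \o cst (f A))) => //.
by move=> t /set_mem /fE /= ->.
Qed.

(** If 0 is a coordinate, integration runs over [[0, 1]] and the shift is 0. Otherwise [S] is the
    singleton of 1, the integral is over a point and only [f top] remains, whence the requirement
    [A = top]. *)
Lemma shifted_step_integral {R : realType} {T : Type} (g : R -> T) (S : set R)
    (A top : T) (f : T -> R) :
  (forall t, 0 <= t < 1 -> g t = A) ->
  S 1 -> (forall y, S y -> y = 0 \/ y = 1) -> S 0 \/ A = top ->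
  \int[lebesgue_measure]_(t in `[inf S, sup S]) f (g t) + f top * inf S = f A.
Proof.
move=> gA S1 S01 S0top.
have lbS : lbound S 0 by move=> y /S01[] ->; rewrite ?ler01.
have ubS : ubound S 1 by move=> y /S01[] ->; rewrite ?ler01.
have [S0|NS0] := pselect (S 0).
  have -> : inf S = 0.
    by apply/eqP; rewrite eq_le lb_le_inf ?ge_inf//; [exists 0|exists 1].
  have -> : sup S = 1.
    by apply/eqP; rewrite eq_le ge_sup ?ub_le_sup//; [exists 1|exists 1].
  by rewrite mulr0 addr0; exact: step_integral.
have -> : S = [set 1]%classic.
  by apply/seteqP; split => y /=; [|by move=> ->]; move=> /[dup] /S01[] ->.
case: S0top => // ->.
by rewrite inf1 sup1 set_itv1 Rintegral_set1 add0r mulr1.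
Qed.

(** * Sup norm and level sets of signed and unsigned indicators *)

(** The norm is a maximum started at 0; [0 <= t] ensures that this default is not what exceeds
    [t]. *)
Lemma normr_row_gt {R : realType} n (x : 'rV[R]_n) t :
  0 <= t -> t < `|x| -> exists j, t < `|x 0 j|.
Proof.
move=> t0; rewrite [`|x|]mx_normrE => /bigmax_gtP[|[[i j] _ /=]].
  by rewrite ltNge t0.
by rewrite ord1; exists j.
Qed.

Lemma normr_coord_le {R : realType} n (x : 'rV[R]_n) j : `|x 0 j| <= `|x|.
Proof.
rewrite [`|x|]mx_normrE.
exact: (le_bigmax _ (fun ij => `|x ij.1 ij.2|) (0, j)).
Qed.

Lemma pair_level_neq0 {R : realType} n (x : 'rV[R]_n) t :
  0 <= t -> t < `|x| -> pair_level x t != (finset.set0, finset.set0).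
Proof.
move=> t0 /(normr_row_gt n x t t0)[j tj]; apply/eqP => -[/setP/(_ j) + /setP/(_ j)].
rewrite !inE mxE => xj /negbT; rewrite -leNgt => Nxj.
by move: tj; rewrite ltNge ler_norml lerNl Nxj leNgt xj.
Qed.

Definition indicator {R : realType} {n} (A : {set 'I_n}) : 'rV[R]_n :=
  \row_j (j \in A)%:R.

(** V appears at negative levels and the empty set from level 1 on; an admissible family contains
    both. *)
Lemma upper_level_indicator {R : realType} n (A : {set 'I_n}) (t : R) :
  upper_level (indicator A) t =
  if t < 0 then [set: 'I_n]%SET else if t < 1 then A else finset.set0.
Proof.
apply/setP => j; rewrite inE mxE; case: (ltP t 0) => t0.
  by rewrite finset.in_setT (lt_le_trans t0).
by case: (ltP t 1) => t1; rewrite ?finset.in_set0; case: (j \in A); rewrite //= ltNge ?t0 ?t1.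
Qed.

Definition signed_indicator {R : realType} {n} (A : {set 'I_n} * {set 'I_n}) : 'rV[R]_n :=
  indicator A.1 - indicator A.2.

Lemma pair_level_signed_indicator {R : realType} n (A : {set 'I_n} * {set 'I_n}) (t : R) :
  [disjoint A.1 & A.2] -> 0 <= t ->
  pair_level (signed_indicator A) t = if t < 1 then A else (finset.set0, finset.set0).
Proof.
(* One side suffices: negating the vector exchanges the two sets. *)
have upper (B C : {set 'I_n}) : [disjoint B & C] -> 0 <= t ->
    upper_level (indicator B - indicator C) t = if t < 1 then B else finset.set0.
  move=> BC t0; apply/setP => j; rewrite inE !mxE.
  case jB: (j \in B).
    by rewrite (disjointFr BC jB) subr0; case: (t < 1); rewrite ?jB ?finset.in_set0.
  rewrite sub0r.
  case: (t < 1); rewrite ?finset.in_set0 ?jB (ltNge, le_gtF)// (le_trans _ t0)// oppr_le0//.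
move=> dA t0; rewrite /pair_level /signed_indicator opprB !upper//.
  by case: ifP => //; case: A dA.
by rewrite disjoint_sym.
Qed.

(** Both bounds are read off level sets: a norm above 1 would make the level pair at 1 nonempty, and
    a norm below 1 would make the level pair at the norm itself equal to [A], although no coordinate
    exceeds the norm in absolute value. *)
Lemma normr_signed_indicator {R : realType} n (A : {set 'I_n} * {set 'I_n}) :
  [disjoint A.1 & A.2] ->
  `|signed_indicator A| = (A != (finset.set0, finset.set0))%:R :> R.
Proof.
move=> dA; apply/eqP; rewrite eq_le; apply/andP; split.
  case: eqP => [->|_] /=; first by rewrite /signed_indicator subrr normr0.
  rewrite leNgt; apply/negP => /(pair_level_neq0 _ _ _ ler01).
  by rewrite pair_level_signed_indicator// ltxx eqxx.
have [_|A0] := eqVneq A (finset.set0, finset.set0); rewrite /= ?normr_ge0//.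
rewrite leNgt; apply/negP => A1.
have := pair_level_signed_indicator _ A _ dA (normr_ge0 (signed_indicator A : 'rV[R]_n)).
rewrite A1 => AE; move: A0; rewrite -AE => /eqP; apply; congr (_, _);
  apply/setP => j; rewrite !inE ltNge; apply/negbF; apply: le_trans (normr_coord_le _ _ j).
  exact: ler_norm.
by rewrite mxE -normrN ler_norm.
Qed.

(** * The four extensions: decomposition and restriction to sets *)

(** Extensions built on upper levels carry the shift by the least coordinate; the paired ones
    integrate from 0 and fall directly under [level_integral_sum]. *)
Lemma lovasz_extension_sum {R : realType} {s : lovasz_setting} {F : {set set_tuple s}}
    {x : vectors R s} :
  admissible F -> feasible_domain F x ->
  exists2 c : set_tuple s -> R, forall A, 0 <= c A
  & forall f : set_tuple s -> R,
    lovasz_extension f x = \sum_(A in F | A != empty_of s) c A * f A.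
Proof.
case: s F x => [n|n|k n|k n] F x /=.
- move=> [_ FT] [x0 Fx]; apply: shifted_integral_sum => //.
  + exact: upper_level_measurable.
  + by move=> _ [j _ <-].
  + by move=> t _ [j _ <-] tj; apply/eqP => /setP/(_ j); rewrite !inE tj.
  + by move=> [_ [j _ _]]; apply/eqP => /setP/(_ j); rewrite !inE.
- move=> _ Fx; apply: (level_integral_sum (pair_level x)).
    exact: pair_level_measurable.
  by move=> t /andP[t0 tx]; rewrite Fx//= pair_level_neq0.
- move=> [_ FT] [x0 Fx]; apply: shifted_integral_sum => //.
  + by apply: dffun_measurable => i; exact: upper_level_measurable.
  + by move=> _ [i _ [j _ <-]].
  + move=> t _ [i _ [j _ <-]] tj; apply/eqP => /ffunP/(_ i).
    by rewrite !ffunE => /setP/(_ j); rewrite !inE tj.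
  + move=> [_ [i _ [j _ _]]]; apply/eqP => /ffunP/(_ i).
    by rewrite !ffunE => /setP/(_ j); rewrite !inE.
- move=> _ Fx; apply: (level_integral_sum (kway_pair_level x)).
    by apply: dffun_measurable => i; exact: pair_level_measurable.
  move=> t /andP[t0 /bigmax_gtP[|[i _ tx]]]; first by rewrite ltNge t0.
  rewrite Fx//=; apply/eqP => /ffunP/(_ i); rewrite !ffunE => /eqP.
  by apply/negP/pair_level_neq0.
Qed.

Lemma indicator01 {R : realType} n (A : {set 'I_n}) j :
  (indicator A : 'rV[R]_n) 0 j = 0 \/ (indicator A : 'rV[R]_n) 0 j = 1.
Proof. by rewrite mxE; case: (j \in A); [right|left]. Qed.

(** The witness is the indicator of [A], signed for pairs. Nonemptiness of [A] provides a coordinate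
    of absolute value 1, which makes integration stop exactly at 1. *)
Lemma lovasz_extension_indicator {R : realType} {s : lovasz_setting}
    {F : {set set_tuple s}} {A : set_tuple s} :
  admissible F -> A \in F -> A != empty_of s ->
  exists2 x : vectors R s, feasible_domain F x
  & forall f : set_tuple s -> R, lovasz_extension f x = f A.
Proof.
case: s F A => [n|n|k n|k n] F A /=.
- move=> [F0 FT] FA /set0Pn[j jA]; exists (indicator A).
    split=> [i|t]; first by rewrite mxE.
    by rewrite upper_level_indicator; case: ifP => // _; case: ifP.
  move=> f; apply: shifted_step_integral.
  + by move=> t /andP[t0 t1]; rewrite upper_level_indicator ltNge t0 t1.
  + by exists j => //; rewrite mxE jA.
  + by move=> _ [i _ <-]; exact: indicator01.
  (* Either [A] is V, or a point outside [A] gives a coordinate 0. *)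
  + have [->|/eqP/setP AT] := eqVneq A [set: _]%SET; [by right|left].
    have [i iA] : exists i, i \notin A.
      apply/existsP; rewrite -negb_forall; apply/forallP => AT'.
      by apply: AT => i; rewrite AT' inE.
    by exists i => //; rewrite mxE (negbTE iA).
- move=> [F0 Fd] FA A0; exists (signed_indicator A).
    by move=> t t0; rewrite pair_level_signed_indicator ?Fd//; case: ifP.
  move=> f; rewrite /pair_lovasz normr_signed_indicator ?Fd// A0.
  apply: step_integral => t /andP[t0 t1].
  by rewrite pair_level_signed_indicator ?Fd// t1.
- move=> [F0 FT] FA A0.
  have [i [j jA]] : exists i j, j \in A i.
    apply: contra_notP (negP A0) => NA; apply/eqP/ffunP => i; rewrite ffunE.
    by apply/setP => j; rewrite inE; apply/negP => jA; apply: NA; exists i, j.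
  have levelE t : kway_level (fun i => indicator (A i) : 'rV[R]_(n i)) t =
      if t < 0 then [ffun i => [set: 'I_(n i)]%SET]
      else if t < 1 then A else [ffun i => finset.set0].
    apply/ffunP => l; rewrite !ffunE upper_level_indicator.
    by case: ifP => _; [|case: ifP => _]; rewrite ?ffunE.
  exists (fun i => indicator (A i)).
    split=> [l q|t]; first by rewrite mxE.
    by rewrite levelE; case: ifP => // _; case: ifP.
  move=> f; apply: shifted_step_integral.
  + by move=> t /andP[t0 t1]; rewrite levelE ltNge t0 t1.
  + by exists i => //; exists j => //; rewrite mxE jA.
  + by move=> _ [l _ [q _ <-]]; exact: indicator01.
  (* If 0 is a coordinate in no block, every component of [A] is full. *)
  + have [?|NS0] := pselect (kway_coords (fun i => indicator (A i) : 'rV[R]_(n i)) 0).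
      by left.
    right; apply/ffunP => l; rewrite ffunE; apply/setP => q; rewrite finset.in_setT.
    apply/negPn/negP => qA; apply: NS0.
    by exists l => //; exists q => //; rewrite mxE (negbTE qA).
- move=> [F0 Fd] FA A0.
  have [i Ai0] : exists i, A i != (finset.set0, finset.set0).
    apply: contra_notP (negP A0) => NA; apply/eqP/ffunP => i; rewrite ffunE.
    by apply/eqP/negPn/negP => Ai; apply: NA; exists i.
  have levelE t : 0 <= t ->
      kway_pair_level (fun i => signed_indicator (A i) : 'rV[R]_(n i)) t =
      if t < 1 then A else [ffun i => (finset.set0, finset.set0)].
    move=> t0; apply/ffunP => l; rewrite ffunE pair_level_signed_indicator ?Fd//.
    by case: ifP => _; rewrite ?ffunE.
  exists (fun i => signed_indicator (A i)).
    by move=> t t0; rewrite levelE//; case: ifP.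
  (* Every block has norm at most 1, and the nonempty component [A i] attains it. *)
  move=> f; rewrite /kway_pair_lovasz (_ : \big[_/_]_(_ < _) _ = 1).
    by apply: step_integral => t /andP[t0 t1]; rewrite levelE// t1.
  apply/eqP; rewrite eq_le; apply/andP; split.
    apply: bigmax_le => // l _; rewrite normr_signed_indicator ?Fd//.
    by case: (_ != _).
  apply: (le_trans _ (le_bigmax _ _ i)).
  by rewrite normr_signed_indicator ?Fd// Ai0.
Qed.

(** * Homogeneous functions on the orthant *)

(** The case [t = 0] lies outside the homogeneity hypothesis: there G(0) = 2^p G(0) with 2^p
    different from 1 forces G(0) = 0. *)
Lemma orthant_homogeneous_root {R : realType} {m} {G : 'rV[R]_m -> R} {p : R} :
  0 < p -> nonneg_valued G -> orthant_homogeneous p G ->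
  forall t a, 0 <= t -> orthant a -> G (t *: a) `^ p^-1 = t * G a `^ p^-1.
Proof.
move=> p0 G0 hG t a t0 a0.
have [-> |tn0] := eqVneq t 0; last first.
  have t_gt0 : 0 < t by rewrite lt_neqAle eq_sym tn0.
  by rewrite hG// powRM ?powR_ge0 ?G0// -powRrM mulfV ?gt_eqF// powRr1.
have o0 : orthant (0 : 'rV[R]_m) by move=> i; rewrite mxE.
have /eqP : G (2 *: 0) = 2 `^ p * G 0 by exact: hG.
rewrite scaler0 -subr_eq0 -{1}[G 0]mul1r -mulrBl mulf_eq0 subr_eq0 eq_sym.
rewrite powR_eq1 (gt_eqF p0) orbF pnatr_eq1 /= ltNge ler0n /= => /eqP GE.
by rewrite scale0r GE powR0 ?mul0r// invr_eq0 gt_eqF.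
Qed.

(** The induction carries membership in the orthant along, since [H] is controlled only there. [H]
    may be negative, so the negated root of [Q] qualifies. *)
Lemma orthant_subadditive_sum {R : realType} {m} {H : 'rV[R]_m -> R} :
  (forall t a, 0 <= t -> orthant a -> H (t *: a) = t * H a) ->
  orthant_subadditive H ->
  forall (T : Type) (r : seq T) (D : pred T) (c : T -> R) (a : T -> 'rV[R]_m),
  (forall A, 0 <= c A) -> (forall A, D A -> orthant (a A)) ->
  H (\sum_(A <- r | D A) c A *: a A) <= \sum_(A <- r | D A) c A * H (a A).
Proof.
move=> hH sH T r D c a c0 a0.
have o0 : orthant (0 : 'rV[R]_m) by move=> i; rewrite mxE.
suff [] : orthant (\sum_(A <- r | D A) c A *: a A) /\
    H (\sum_(A <- r | D A) c A *: a A) <= \sum_(A <- r | D A) c A * H (a A) by [].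
apply: (big_rec2 (fun u v => orthant u /\ H u <= v)) => [|A v u DA [u0 uv]].
  by split=> //; rewrite -(scale0r (0 : 'rV[R]_m)) hH// mul0r.
have ca0 : orthant (c A *: a A) by move=> i; rewrite mxE mulr_ge0// a0.
split; first by move=> i; rewrite mxE addr_ge0.
by rewrite (le_trans (sH _ _ ca0 u0))// lerD// hH//; exact: a0.
Qed.

(** With u the combination, P(u)^(1/p) <= sum c_A P(a_A)^(1/p) <= K^(1/p) sum c_A Q(a_A)^(1/p) <= (K
    Q(u))^(1/p); raising to the power p concludes. *)
Lemma ratio_bound_sum {R : realType} {m} {p : R} {P Q : 'rV[R]_m -> R} :
  0 < p -> nonneg_valued P -> nonneg_valued Q ->
  orthant_homogeneous p P -> orthant_homogeneous p Q ->
  orthant_subadditive (fun a => P a `^ p^-1) ->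
  orthant_superadditive (fun a => Q a `^ p^-1) ->
  forall (T : Type) (r : seq T) (D : pred T) (c : T -> R) (a : T -> 'rV[R]_m) (K : R),
  0 <= K -> (forall A, 0 <= c A) -> (forall A, D A -> orthant (a A)) ->
  (forall A, D A -> P (a A) <= K * Q (a A)) ->
  P (\sum_(A <- r | D A) c A *: a A) <= K * Q (\sum_(A <- r | D A) c A *: a A).
Proof.
move=> p0 P0 Q0 hP hQ sP sQ T r D c a K K0 c0 a0 PKQ.
set u := \sum_(_ <- _ | _) _.
have u0 : orthant u.
  by move=> i; rewrite summxE sumr_ge0// => A DA; rewrite mxE mulr_ge0// a0.
have ip0 : 0 <= p^-1 by rewrite invr_ge0 ltW.
have rootK x : 0 <= x -> (x `^ p^-1) `^ p = x.
  by move=> x0; rewrite -powRrM mulVf ?gt_eqF// powRr1.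
rewrite -(rootK (P u)) ?P0// -(rootK (K * Q u)) ?mulr_ge0 ?Q0//.
apply: ge0_ler_powR; rewrite ?nnegrE ?powR_ge0// ?(ltW p0)//.
apply: (le_trans (orthant_subadditive_sum (orthant_homogeneous_root p0 P0 hP) sP _ r D c a c0 a0)).
(* Superadditivity of the root of [Q] is used as subadditivity of its negative. *)
have hN t b : 0 <= t -> orthant b -> - (Q (t *: b) `^ p^-1) = t * - (Q b `^ p^-1).
  by move=> t0 b0; rewrite (orthant_homogeneous_root p0)// mulrN.
have sN : orthant_subadditive (fun b => - (Q b `^ p^-1)).
  by move=> b d b0 d0; rewrite -opprD lerN2; exact: sQ.
have /= := orthant_subadditive_sum hN sN _ r D c a c0 a0.
rewrite -/u; under eq_bigr do rewrite mulrN.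
rewrite sumrN lerN2 powRM ?Q0// => /(ler_wpM2l (powR_ge0 K p^-1)).
apply: le_trans; rewrite mulr_sumr; apply: ler_sum => A DA.
rewrite mulrCA ler_wpM2l// -powRM ?Q0 ?a0//; last exact: a0.
apply: ge0_ler_powR; rewrite ?nnegrE ?mulr_ge0 ?P0 ?Q0//; try exact: a0.
exact: PKQ.
Qed.

(** * Equality of the discrete and continuous optima *)

Lemma ext_valuesE {R : realType} {s : lovasz_setting} {F : {set set_tuple s}} {x : vectors R s} :
  admissible F -> feasible_domain F x ->
  exists2 c : set_tuple s -> R, forall A, 0 <= c A
  & forall m (f : 'I_m -> set_tuple s -> R),
    ext_values f x = \sum_(A in F | A != empty_of s) c A *: set_values f A.
Proof.
move=> hF Fx; have [c c0 cE] := lovasz_extension_sum hF Fx.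
exists c => // m f; apply/rowP => i; rewrite mxE cE summxE.
by apply: eq_bigr => A _; rewrite !mxE.
Qed.

Lemma ext_values_indicator {R : realType} {s : lovasz_setting}
    {F : {set set_tuple s}} {A : set_tuple s} :
  admissible F -> A \in F -> A != empty_of s ->
  exists2 x : vectors R s, feasible_domain F x
  & forall m (f : 'I_m -> set_tuple s -> R), ext_values f x = set_values f A.
Proof.
move=> hF FA A0; have [x Fx xE] := lovasz_extension_indicator (R := R) hF FA A0.
by exists x => // m f; apply/rowP => i; rewrite !mxE xE.
Qed.

(** In the first half, [Q] can be positive at a sum of vectors where it vanishes, as min(a_1, a_2)
    is for (1, 0) and (0, 1). The existence of a positive denominator and the vanishing of [P] along
    with [Q] handle this. *)
Theorem theoremC (R : realType) (s : lovasz_setting) (F : {set set_tuple s})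
    (hF : admissible F) (m : nat) (f : 'I_m -> set_tuple s -> R)
    (hf : forall i A, A \in F -> 0 <= f i A)
    (p : R) (hp : 0 < p) (P Q : 'rV[R]_m -> R)
    (hP0 : nonneg_valued P) (hQ0 : nonneg_valued Q)
    (hP : orthant_homogeneous p P) (hQ : orthant_homogeneous p Q) :
  (orthant_subadditive (fun a => P a `^ p^-1) ->
   orthant_superadditive (fun a => Q a `^ p^-1) ->
   (exists A, [/\ A \in F, A != empty_of s & 0 < Q (set_values f A)]) ->
   (forall A, A \in F -> A != empty_of s ->
      Q (set_values f A) = 0 -> P (set_values f A) = 0) ->
   \big[maxe/-oo%E]_(A in F | (A != empty_of s) && (0 < Q (set_values f A)))
      (P (set_values f A) / Q (set_values f A))%:E
   = ereal_sup [set (P (ext_values f x) / Q (ext_values f x))%:E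
                 | x in [set x | feasible_domain F x /\ 0 < Q (ext_values f x)]]%classic)
  /\
  (orthant_superadditive (fun a => P a `^ p^-1) ->
   orthant_subadditive (fun a => Q a `^ p^-1) ->
   \big[mine/+oo%E]_(A in F | (A != empty_of s) && (0 < Q (set_values f A)))
      (P (set_values f A) / Q (set_values f A))%:E
   = ereal_inf [set (P (ext_values f x) / Q (ext_values f x))%:E
                 | x in [set x | feasible_domain F x /\ 0 < Q (ext_values f x)]]%classic).
Proof.
pose DA A := (A \in F) && (A != empty_of s).
pose DQ A := (A \in F) && ((A != empty_of s) && (0 < Q (set_values f A))).
have orth A : DA A -> orthant (set_values f A).
  by move=> /andP[FA _] i; rewrite mxE hf.
(* Every discrete ratio is also a continuous one, which gives the easy inequality in both halves. *)
have attained A : DQ A -> exists2 x, feasible_domain F x /\ 0 < Q (ext_values f x)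
    & (P (ext_values f x) / Q (ext_values f x))%:E =
      (P (set_values f A) / Q (set_values f A))%:E.
  move=> /and3P[FA A0 QA]; have [x Fx xE] := ext_values_indicator (R := R) hF FA A0.
  by exists x; rewrite xE.
split=> [sP sQ [A0 [FA0 A00 QA0]] PQ0|sP sQ]; apply/eqP; rewrite eq_le.
- apply/andP; split.
    apply: bigmax_le => [|A /attained[x Fx <-]]; first exact: leNye.
    by apply: ereal_sup_ubound; exists x.
  (* The maximum is attained at some [A1], so it is a real number that can serve as the constant
     K. *)
  have DA0 : DQ A0 by rewrite /DQ FA0 A00.
  have [A1 /and3P[FA1 A1n0 QA1] maxE] := eq_bigmax (x := -oo%E) A0 DQ
    (fun A => (P (set_values f A) / Q (set_values f A))%:E) DA0 (fun _ _ => leNye _).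
  apply: ge_ereal_sup => _ [x [Fx Qx] <-].
  rewrite -/DQ maxE lee_fin ler_pdivrMr//.
  have [c c0 cE] := ext_valuesE hF Fx; rewrite cE.
  apply: (ratio_bound_sum hp) => // [|A DAA].
    by rewrite divr_ge0 ?hP0 ?hQ0//; apply: orth; rewrite /DA FA1.
  have /andP[FA An0] := DAA; have := hQ0 _ (orth A DAA).
  (* Maximality bounds [P] only where [Q] is positive; where [Q] is 0, the bound asks for [P] to
     vanish. *)
  rewrite le_eqVlt => /predU1P[/esym QA|QA]; first by rewrite QA PQ0// mulr0.
  rewrite -ler_pdivrMr// -lee_fin -maxE.
  by apply: (le_bigmax_cond _ (fun A => (P (set_values f A) / Q (set_values f A))%:E)); apply/and3P.
- apply/andP; split; last first.
    apply: le_bigmin => [|A /attained[x Fx <-]]; first exact: leey.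
    by apply: ereal_inf_lbound; exists x.
  apply: le_ereal_inf_tmp => _ [x [Fx Qx] <-].
  have [c c0 cE] := ext_valuesE hF Fx.
  have ux : orthant (ext_values f x).
    move=> i; rewrite cE summxE sumr_ge0// => A DAA.
    by rewrite mxE mulr_ge0// orth.
  (* If [Q] is positive at no [A], the bound with [P] and [Q] exchanged and constant 0 gives
     [Q <= 0] at [x], contradicting [Qx]. *)
  have [[A0 DA0]|NDQ] := pselect (exists A, DQ A); last first.
    suff : Q (ext_values f x) <= 0 * P (ext_values f x) by rewrite mul0r leNgt Qx.
    rewrite cE; apply: (ratio_bound_sum hp) => // A DAA.
    rewrite mul0r leNgt; apply/negP => QA; apply: NDQ; exists A.
    by have /andP[FA An0] := DAA; apply/and3P.
  have [A1 /and3P[FA1 A1n0 QA1] minE] := eq_bigmin (x := +oo%E) A0 DQ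
    (fun A => (P (set_values f A) / Q (set_values f A))%:E) DA0 (fun _ _ => leey _).
  rewrite -/DQ minE lee_fin ler_pdivlMr//.
  (* A zero minimum is a trivial lower bound; a positive one is inverted to serve as the constant in
     Q <= K^(-1) P. *)
  have := hP0 _ (orth A1 (introT andP (conj FA1 A1n0))).
  rewrite le_eqVlt => /predU1P[<-|PA1]; first by rewrite !mul0r hP0.
  have K0 : 0 < P (set_values f A1) / Q (set_values f A1) by rewrite divr_gt0.
  rewrite -ler_pdivlMl// cE; apply: (ratio_bound_sum hp) => // [|A DAA].
    by rewrite invr_ge0 ltW.
  have /andP[FA An0] := DAA; have := hQ0 _ (orth A DAA).
  rewrite le_eqVlt => /predU1P[<-|QA].
    by rewrite mulr_ge0 ?hP0 ?invr_ge0 ?(ltW K0)//; exact: orth.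
  rewrite ler_pdivlMl// -ler_pdivlMr// -lee_fin -minE.
  by apply: (bigmin_le_cond _ (fun A => (P (set_values f A) / Q (set_values f A))%:E)); apply/and3P.
Qed.
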